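(* Let $K$ be a group, let $(PQR): P\xrightarrow{\bar\jmath}Q\xrightarrow{\bar\phi}R$ be a group extension, let $\theta:Q\to\mathrm{Out}(K)$ be an outer action, and let $(KNP): K\xrightarrow{i_0}N\xrightarrow{\pi_0}P$ be a group extension. Let $(G,j,\pi)$ be an iterated extension of $(KNP)$ by $(PQR)$ whose $Q$-main extension $(KGQ)=(G,i,\pi)$ has outer action $\theta$. Then the inclusion homomorphism $\mathrm{Aut}(KNGQR)\hookrightarrow\mathrm{Aut}(KGQ)$ induces an injective homomorphism $$\mathrm{Out}(KNGQR;K)\hookrightarrow\mathrm{Out}(KGQ;K).$$ In other words, an automorphism $\xi\in\mathrm{Aut}(KNGQR)$ lies in $\complement_G(Z(K))$ if and only if it lies in $\complement_G(Z(K)^P)$.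
   Context: Extensions. An extension of $K$ by $Q$ is a triple $(G,i,\pi)$ with $i:K\to G$ an injective homomorphism, $\pi:G\to Q$ a surjective homomorphism, $i(K)=\mathrm{Ker}(\pi)$; $K$ is identified with $i(K)$ (and likewise for other injections). Conjugation of $G$ on $K$ induces a homomorphism $Q\to\mathrm{Out}(K)=\mathrm{Aut}(K)/\mathrm{Inn}(K)$, the outer action of the extension. The outer action $\theta$ induces an action of $Q$ on the centre $Z(K)$; $P$ is regarded as a normal subgroup of $Q$ via $\bar\jmath$, and $Z(K)^P$ is the subgroup of $P$-fixed elements. Iterated extensions. An iterated extension of $(KNP)$ by $(PQR)$ is a triple $(G,j,\pi)$ with $G$ a group, $j:N\to G$ an injective homomorphism and $\pi:G\to Q$ a surjective homomorphism such that, with $i:=j\circ i_0$ and $\phi:=\bar\phi\circ\pi$, one has $\pi\circ j=\bar\jmath\circ\pi_0$, $j(N)=\mathrm{Ker}(\phi)$ and $i(K)=\mathrm{Ker}(\pi)$. Its $Q$-main extension is the extension $(G,i,\pi)$ of $K$ by $Q$. Automorphisms. $\mathrm{Aut}(KNGQR):=\{\xi\in\mathrm{Aut}(G):\xi\circ j=j,\ \pi\circ\xi=\pi\}$ and $\mathrm{Aut}(KGQ):=\{\xi\in\mathrm{Aut}(G):\xi\circ i=i,\ \pi\circ\xi=\pi\}$. For a subset $S\subseteq G$, $\complement_G(S)$ is the set of inner automorphisms $x\mapsto gxg^{-1}$ of $G$ with $g\in S$. $\mathrm{Aut}_K(G)$ (resp. $\mathrm{Aut}_{N,K}(G)$) is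 the group of automorphisms of $G$ stabilizing $K$ (resp. both $N$ and $K$); $\mathrm{Out}(G;K):=\mathrm{Aut}_K(G)/\complement_G(K)$ and $\mathrm{Out}_N(G;K):=\mathrm{Aut}_{N,K}(G)/\complement_G(K)$. $\mathrm{Out}(KNGQR;K)$ is the image of $\mathrm{Aut}(KNGQR)$ in $\mathrm{Out}_N(G;K)$, equal to $\mathrm{Aut}(KNGQR)/\complement_G(Z(K)^P)$; $\mathrm{Out}(KGQ;K)$ is the image of $\mathrm{Aut}(KGQ)$ in $\mathrm{Out}(G;K)$, equal to $\mathrm{Aut}(KGQ)/\complement_G(Z(K))$. *)

(* Defs.v *)
From HB Require Import structures.
From mathcomp Require Import ssreflect ssrfun ssrbool eqtype ssrnat choice.
From mathcomp Require Import monoid generic_quotient boolp classical_sets.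

Set Implicit Arguments.
Unset Strict Implicit.
Unset Printing Implicit Defensive.

Local Open Scope classical_set_scope.
Local Open Scope group_scope.

(* MathComp's [groupType] is an arbitrary, possibly infinite, group. *)

Notation "{ 'hom' G -> H }" := (UMagmaMorphism.type G H)
  (at level 0, G at level 98, H at level 99, format "{ 'hom'  G  ->  H }")
  : type_scope.

Definition ker (G H : groupType) (f : G -> H) : set G := [set x | f x = 1].

Record subgroup (G : groupType) := Subgroup {
  sgset : set G;
  sgset1 : sgset 1;
  sgsetM : forall x y, sgset x -> sgset y -> sgset (x * y);
  sgsetV : forall x, sgset x -> sgset x^-1 }.

Section SubgroupGroup.
Variables (G : groupType) (H : subgroup G).

Definition sgpred : pred G := fun x => x \in sgset H.

Lemma sgpred_closed : group_closed sgpred.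
Proof.
split=> [|x y]; first exact: mem_set (sgset1 H).
by move=> /set_mem Hx /set_mem Hy; apply: mem_set (sgsetM Hx (sgsetV Hy)).
Qed.

Record subgroup_sort : Type := InSubgroup {
  sgval : G;
  sgvalP : sgpred sgval }.
HB.instance Definition _ := [isSub for sgval].
HB.instance Definition _ := [Choice of subgroup_sort by <:].
HB.instance Definition _ :=
  SubChoice_isSubGroup.Build G sgpred subgroup_sort sgpred_closed.

Definition subgroup_group : groupType := subgroup_sort.

Lemma subgroup_valP (x : subgroup_sort) : sgset H (val x).
Proof. exact: set_mem (valP x). Qed.

Definition in_sg (x : G) (Hx : sgset H x) : subgroup_sort :=
  InSubgroup (mem_set Hx).

End SubgroupGroup.

Coercion subgroup_group : subgroup >-> Group.type.

Section Inclusion.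
Variables (G : groupType) (A B : subgroup G) (sAB : sgset A `<=` sgset B).

Definition sg_incl (x : A) : B := in_sg (sAB (subgroup_valP x)).

Lemma sg_incl_morphism : {morph sg_incl : x y / x / y}.
Proof. by move=> x y; apply: val_inj. Qed.
HB.instance Definition _ := isGroupMorphism.Build A B sg_incl sg_incl_morphism.

End Inclusion.

Section Image.
Variables (G H : groupType) (f : {hom G -> H}).

Lemma image_sg1 : range f 1.
Proof. by exists 1 => //; rewrite gmulf1. Qed.
Lemma image_sgM x y : range f x -> range f y -> range f (x * y).
Proof. by move=> [a _ <-] [b _ <-]; exists (a * b) => //; rewrite gmulfM. Qed.
Lemma image_sgV x : range f x -> range f x^-1.
Proof. by move=> [a _ <-]; exists a^-1 => //; rewrite gmulfV. Qed.

Definition image_sg : subgroup H := Subgroup image_sg1 image_sgM image_sgV.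

Definition to_image (x : G) : image_sg :=
  in_sg (H := image_sg) (ex_intro2 _ _ x I erefl).

Lemma to_image_morphism : {morph to_image : x y / x / y}.
Proof. by move=> x y; apply: val_inj; rewrite /= gmulfF. Qed.
HB.instance Definition _ :=
  isGroupMorphism.Build G image_sg to_image to_image_morphism.

End Image.

Section Intersection.
Variables (G : groupType) (A B : subgroup G).

Lemma setI_sg1 : (sgset A `&` sgset B) 1. Proof. by split; apply: sgset1. Qed.
Lemma setI_sgM x y : (sgset A `&` sgset B) x -> (sgset A `&` sgset B) y -> (sgset A `&` sgset B) (x * y).
Proof. by move=> [? ?] [? ?]; split; apply: sgsetM. Qed.
Lemma setI_sgV x : (sgset A `&` sgset B) x -> (sgset A `&` sgset B) x^-1.
Proof. by move=> [? ?]; split; apply: sgsetV. Qed.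

Definition setI_sg : subgroup G := Subgroup setI_sg1 setI_sgM setI_sgV.

End Intersection.

Record normal_subgroup (G : groupType) := NormalSubgroup {
  nsgset :> subgroup G;
  nsgsetJ : forall g x, sgset nsgset x -> sgset nsgset (g * x * g^-1) }.

Section Quotient.
Variables (G : groupType) (N : normal_subgroup G).

Definition coset_rel : rel G := fun x y => `[< sgset N (x^-1 * y) >].

Lemma coset_rel_refl : reflexive coset_rel.
Proof. by move=> x; apply/asboolP; rewrite mulVg; apply: sgset1. Qed.
Lemma coset_rel_sym : symmetric coset_rel.
Proof.
move=> x y; apply/asboolP/asboolP => /sgsetV; by rewrite invgM invgK.
Qed.
Lemma coset_rel_trans : transitive coset_rel.
Proof.
move=> y x z /asboolP xy /asboolP yz; apply/asboolP.
by have := sgsetM xy yz; rewrite mulgA mulgK.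
Qed.

Canonical coset_equiv :=
  EquivRel coset_rel coset_rel_refl coset_rel_sym coset_rel_trans.

Definition quot_sort : Type := {eq_quot coset_equiv}%qT.
HB.instance Definition _ := Choice.on quot_sort.

Definition coset (x : G) : quot_sort := (\pi_({eq_quot coset_equiv}) x)%qT.
Definition coset_repr (u : quot_sort) : G := repr (u : {eq_quot coset_equiv}%qT).

Lemma coset_reprK : cancel coset_repr coset.
Proof. by move=> u; rewrite /coset /coset_repr reprK. Qed.

Lemma coset_eq x y : coset x = coset y <-> sgset N (x^-1 * y).
Proof.
split=> [/eqmodP/asboolP //|xy]; apply/eqmodP; exact/asboolP.
Qed.

Definition coset_mul (u v : quot_sort) := coset (coset_repr u * coset_repr v).
Definition coset_inv (u : quot_sort) := coset (coset_repr u)^-1.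

Lemma coset_mulE x y : coset_mul (coset x) (coset y) = coset (x * y).
Proof.
have /coset_eq xN := coset_reprK (coset x).
have /coset_eq yN := coset_reprK (coset y).
apply/coset_eq; rewrite invgM.
move: (coset_repr _) (coset_repr _) xN yN => a b aN bN.
have := sgsetM bN (nsgsetJ y^-1 aN).
by rewrite invgK !mulgA mulgK.
Qed.

Lemma coset_invE x : coset_inv (coset x) = coset x^-1.
Proof.
have /coset_eq xN := coset_reprK (coset x).
apply/coset_eq; rewrite invgK; move: (coset_repr _) xN => a aN.
by have := sgsetV (nsgsetJ a aN); rewrite mulVKg invgM invgK.
Qed.

Lemma coset_surj u : exists x, u = coset x.
Proof. by exists (coset_repr u); rewrite coset_reprK. Qed.

Lemma coset_mulA : associative coset_mul.
Proof.
move=> u v w; have [x ->] := coset_surj u; have [y ->] := coset_surj v.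
by have [z ->] := coset_surj w; rewrite !coset_mulE mulgA.
Qed.
Lemma coset_mul1 : left_id (coset 1) coset_mul.
Proof. by move=> u; have [x ->] := coset_surj u; rewrite coset_mulE mul1g. Qed.
Lemma coset_1mul : right_id (coset 1) coset_mul.
Proof. by move=> u; have [x ->] := coset_surj u; rewrite coset_mulE mulg1. Qed.
Lemma coset_mulV : left_inverse (coset 1) coset_inv coset_mul.
Proof.
by move=> u; have [x ->] := coset_surj u; rewrite coset_invE coset_mulE mulVg.
Qed.
Lemma coset_Vmul : right_inverse (coset 1) coset_inv coset_mul.
Proof.
by move=> u; have [x ->] := coset_surj u; rewrite coset_invE coset_mulE mulgV.
Qed.

HB.instance Definition _ := isGroup.Build quot_sort
  coset_mulA coset_mul1 coset_1mul coset_mulV coset_Vmul.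

Definition quot : groupType := quot_sort.

Lemma coset_morphism : {morph (coset : G -> quot) : x y / x / y}.
Proof. by move=> x y; rewrite -coset_mulE -coset_invE. Qed.
HB.instance Definition _ := isGroupMorphism.Build G quot coset coset_morphism.

End Quotient.

Record Aut_sort (G : groupType) : Type := MkAut {
  aut_fun :> G -> G;
  autM : {morph aut_fun : x y / x * y};
  aut_bij : bijective aut_fun }.

HB.instance Definition _ (G : groupType) := gen_eqMixin (Aut_sort G).
HB.instance Definition _ (G : groupType) := gen_choiceMixin (Aut_sort G).

Section AutGroup.
Variable G : groupType.
Implicit Types f g h : Aut_sort G.

Lemma aut_eq f g : f =1 g -> f = g.
Proof.
case: f g => [f fM fB] [g gM gB] /= /funext fg.
by rewrite -{}fg in gM gB *; congr MkAut; apply: Prop_irrelevance.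
Qed.

Definition aut_one : Aut_sort G :=
  MkAut (aut_fun := id) (fun x y => erefl) (Bijective (g := id) (fun=> erefl) (fun=> erefl)).

Lemma aut_mulM f g : {morph f \o g : x y / x * y}.
Proof. by move=> x y; rewrite /= !autM. Qed.

Definition aut_mul f g : Aut_sort G :=
  MkAut (aut_mulM f g) (bij_comp (aut_bij f) (aut_bij g)).

Lemma aut_inv_subproof f : exists g : G -> G, cancel f g /\ cancel g f.
Proof. by have [g] := aut_bij f; exists g. Qed.

Definition aut_inv_fun f : G -> G := sval (cid (aut_inv_subproof f)).

Lemma aut_invK f : cancel f (aut_inv_fun f).
Proof. by rewrite /aut_inv_fun; case: cid => ? []. Qed.
Lemma aut_Kinv f : cancel (aut_inv_fun f) f.
Proof. by rewrite /aut_inv_fun; case: cid => ? []. Qed.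

Lemma aut_invM f : {morph aut_inv_fun f : x y / x * y}.
Proof.
by move=> x y; apply: (can_inj (aut_invK f)); rewrite autM !aut_Kinv.
Qed.

Definition aut_inv f : Aut_sort G :=
  MkAut (@aut_invM f) (Bijective (aut_Kinv f) (aut_invK f)).

Lemma aut_mulA : associative aut_mul.
Proof. by move=> f g h; apply: aut_eq. Qed.
Lemma aut_mul1 : left_id aut_one aut_mul.
Proof. by move=> f; apply: aut_eq. Qed.
Lemma aut_1mul : right_id aut_one aut_mul.
Proof. by move=> f; apply: aut_eq. Qed.
Lemma aut_mulV : left_inverse aut_one aut_inv aut_mul.
Proof. by move=> f; apply: aut_eq => x; apply: aut_invK. Qed.
Lemma aut_Vmul : right_inverse aut_one aut_inv aut_mul.
Proof. by move=> f; apply: aut_eq => x; apply: aut_Kinv. Qed.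

HB.instance Definition _ := isGroup.Build (Aut_sort G)
  aut_mulA aut_mul1 aut_1mul aut_mulV aut_Vmul.

Definition Aut : groupType := Aut_sort G.

Lemma inner_subproofM (g : G) : {morph (fun x => g * x * g^-1) : x y / x * y}.
Proof. by move=> x y; rewrite !mulgA mulgVK. Qed.
Lemma inner_subproofB (g : G) : bijective (fun x => g * x * g^-1).
Proof.
exists (fun x => g^-1 * x * g) => x; first by rewrite !mulgA mulVg mul1g mulgVK.
by rewrite !mulgA mulgV mul1g mulgK.
Qed.

Definition inner (g : G) : Aut := MkAut (inner_subproofM g) (inner_subproofB g).

Lemma inner_morphism : {morph inner : x y / x / y}.
Proof.
move=> x y.
have H : {morph inner : x y / x * y}.
  by move=> a b; apply: aut_eq => u /=; rewrite invgM !mulgA.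
suff -> : (inner y)^-1 = inner y^-1 by rewrite H.
apply: (mulgI (inner y)); rewrite mulgV -H mulgV.
by apply: aut_eq => u /=; rewrite mul1g invg1 mulg1.
Qed.
HB.instance Definition _ := isGroupMorphism.Build G Aut inner inner_morphism.

Lemma innerM : {morph inner : x y / x * y}. Proof. exact: gmulfM. Qed.
Lemma innerV : {morph inner : x / x^-1}. Proof. exact: gmulfV. Qed.

Lemma aut_inner (f : Aut) (g : G) : f * inner g * f^-1 = inner (f g).
Proof.
have f1 : f 1 = 1 by apply: (mulgI (f 1)); rewrite mulg1 -autM mulg1.
have fV x : f x^-1 = (f x)^-1.
  by apply: (mulgI (f x)); rewrite mulgV -autM mulgV.
apply: aut_eq => x.
by rewrite -[LHS]/(f (g * aut_inv f x * g^-1)) !autM fV [f (aut_inv f x)]aut_Kinv.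
Qed.

Definition inner_set (S : set G) : set Aut := inner @` S.

Lemma Inn_normal (f x : Aut) :
  sgset (image_sg inner) x -> sgset (image_sg inner) (f * x * f^-1).
Proof. by move=> [g _ <-]; exists (f g) => //; rewrite aut_inner. Qed.

Definition Inn : normal_subgroup Aut := NormalSubgroup Inn_normal.

Definition Out : groupType := quot Inn.

Definition Aut_stab_set (S : set G) : set Aut := [set f : Aut | f @` S = S].

Lemma Aut_stab1 S : Aut_stab_set S 1.
Proof. exact: image_id. Qed.
Lemma Aut_stabM S f g :
  Aut_stab_set S f -> Aut_stab_set S g -> Aut_stab_set S (f * g).
Proof.
rewrite /Aut_stab_set /= => fS gS.
by rewrite [X in X @` _]/(f \o g) -image_comp gS fS.
Qed.
Lemma Aut_stabV S f : Aut_stab_set S f -> Aut_stab_set S f^-1.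
Proof.
rewrite /Aut_stab_set /= => fS; rewrite predeqE => x; split=> [[y Sy <-]|Sx].
  by move: Sy; rewrite -{1}fS => -[z Sz <-]; rewrite [X in S X]aut_invK.
exists (f x); last exact: aut_invK.
by rewrite -fS; exists x.
Qed.

Definition Aut_stab (S : set G) : subgroup Aut :=
  Subgroup (@Aut_stab1 S) (@Aut_stabM S) (@Aut_stabV S).

End AutGroup.


Section AutRel.
Variables (A G Q : groupType) (f : {hom A -> G}) (p : {hom G -> Q}).

Definition Aut_rel_set : set (Aut G) :=
  [set xi : Aut G | (forall a, xi (f a) = f a) /\ (forall g, p (xi g) = p g)].

Lemma Aut_rel1 : Aut_rel_set 1. Proof. by []. Qed.
Lemma Aut_relM xi zeta :
  Aut_rel_set xi -> Aut_rel_set zeta -> Aut_rel_set (xi * zeta).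
Proof.
move=> [xif pxi] [zf pz]; split=> [a|g].
  by rewrite -[LHS]/(xi (zeta (f a))) zf.
by rewrite -[LHS]/(p (xi (zeta g))) pxi.
Qed.
Lemma Aut_relV xi : Aut_rel_set xi -> Aut_rel_set xi^-1.
Proof.
move=> [xif pxi]; split=> [a|g]; first by rewrite -{1}xif; apply: aut_invK.
by rewrite -[RHS](congr1 p (aut_Kinv xi g)) pxi.
Qed.

Definition Aut_rel : subgroup (Aut G) := Subgroup Aut_rel1 Aut_relM Aut_relV.

Lemma Aut_rel_stab : sgset Aut_rel `<=` sgset (Aut_stab (range f)).
Proof.
move=> xi [xif _]; rewrite /= /Aut_stab_set /= image_comp; congr (_ @` _).
exact: funext.
Qed.

End AutRel.

Definition center (K : groupType) : set K := [set z | forall k, z * k = k * z].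
Arguments center K : clear implicits.

Record extension (K Q : groupType) := Extension {
  ext_group : groupType;
  ext_inj : {hom K -> ext_group};
  ext_proj : {hom ext_group -> Q};
  ext_inj_injective : injective ext_inj;
  ext_proj_surjective : range ext_proj = setT;
  ext_exact : range ext_inj = ker ext_proj }.

Section OuterAction.
Variables (K Q : groupType) (X : extension K Q).
Local Notation G := (ext_group X).
Local Notation i := (ext_inj X).
Local Notation pi := (ext_proj X).

Lemma ext_conj_ex (g : G) (k : K) : exists k', i k' = g * i k * g^-1.
Proof.
suff: range i (g * i k * g^-1) by case=> k' _; exists k'.
have : range i (i k) by exists k.
rewrite ext_exact /ker /= => ik.
by rewrite !gmulfM ik mulg1 -gmulfM mulgV gmulf1.
Qed.

Definition ext_conj_fun (g : G) (k : K) : K := sval (cid (ext_conj_ex g k)).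

Lemma ext_conj_funE g k : i (ext_conj_fun g k) = g * i k * g^-1.
Proof. by rewrite /ext_conj_fun; case: cid. Qed.

Lemma ext_conj_funM g : {morph ext_conj_fun g : x y / x * y}.
Proof.
move=> x y; apply: (@ext_inj_injective _ _ X).
by rewrite [RHS]gmulfM !ext_conj_funE gmulfM !mulgA mulgVK.
Qed.

Lemma ext_conj_funK g : cancel (ext_conj_fun g) (ext_conj_fun g^-1).
Proof.
move=> k; apply: (@ext_inj_injective _ _ X).
by rewrite !ext_conj_funE invgK !mulgA mulVg mul1g mulgVK.
Qed.

Lemma ext_conj_funVK g : cancel (ext_conj_fun g^-1) (ext_conj_fun g).
Proof. by move=> k; rewrite -{1}[g]invgK ext_conj_funK. Qed.

Definition ext_conj (g : G) : Aut K :=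
  MkAut (@ext_conj_funM g) (Bijective (ext_conj_funK g) (ext_conj_funVK g)).

Lemma ext_conj_morphism : {morph ext_conj : x y / x / y}.
Proof.
have H : {morph ext_conj : x y / x * y}.
  move=> x y; apply: aut_eq => k; apply: (@ext_inj_injective _ _ X).
  rewrite -[RHS]/(i (ext_conj_fun x (ext_conj_fun y k))).
  rewrite -[LHS]/(i (ext_conj_fun (x * y) k)) !ext_conj_funE.
  by rewrite invgM !mulgA.
move=> x y; rewrite H; congr (_ * _).
apply: (mulgI (ext_conj y)); rewrite mulgV -H mulgV.
by apply: aut_eq => k; apply: (@ext_inj_injective _ _ X);
  rewrite /= ext_conj_funE mul1g invg1 mulg1.
Qed.
HB.instance Definition _ := isGroupMorphism.Build G (Aut K) ext_conj ext_conj_morphism.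

Lemma ext_lift_ex (q : Q) : exists g, pi g = q.
Proof.
have : range pi q by rewrite ext_proj_surjective.
by case=> g _; exists g.
Qed.

(* By [outer_actionE], the choice of a preimage of q is irrelevant. *)
Definition outer_action_fun (q : Q) : Out K :=
  coset (Inn K) (ext_conj (sval (cid (ext_lift_ex q)))).

Lemma outer_actionE (g : G) :
  outer_action_fun (pi g) = coset (Inn K) (ext_conj g).
Proof.
rewrite /outer_action_fun; case: cid => h /= hg.
apply/coset_eq.
have : ker pi (h^-1 * g) by rewrite /ker /= gmulfM gmulfV hg mulVg.
rewrite -ext_exact => -[k _ kE]; exists k => //.
rewrite -gmulfV -gmulfM -kE; apply: aut_eq => x; apply: (@ext_inj_injective _ _ X).
by rewrite /= ext_conj_funE !gmulfM gmulfV.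
Qed.

Lemma outer_action_morphism : {morph outer_action_fun : x y / x / y}.
Proof.
move=> x y; have [g <-] := ext_lift_ex x; have [h <-] := ext_lift_ex y.
by rewrite -gmulfF !outer_actionE !gmulfF.
Qed.
HB.instance Definition _ :=
  isGroupMorphism.Build Q (Out K) outer_action_fun outer_action_morphism.

(* The homomorphism Q -> Out(K) induced by conjugation of G on K. *)
Definition outer_action : {hom Q -> Out K} := outer_action_fun.

End OuterAction.

Section CenterAction.
Variables (K Q : groupType) (theta : {hom Q -> Out K}).

(* By [center_actionE], the choice of a representative of theta(q) is
   irrelevant on the centre of K. *)
Definition center_action (q : Q) (z : K) : K := (coset_repr (theta q) : Aut K) z.

Lemma center_actionE (q : Q) (f : Aut K) (z : K) :
  theta q = coset (Inn K) f -> center K z -> center_action q z = f z.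
Proof.
rewrite /center_action => -> zK.
have /coset_eq [k _ kE] := coset_reprK (coset (Inn K) f).
set r := coset_repr _ in kE *.
have -> : f = r * inner k by rewrite kE mulVKg.
by rewrite -[RHS]/(r (k * z * k^-1)) -zK mulgK.
Qed.

(* Z(K)^P, for P acting through f : P -> Q *)
Definition fixed_center (P : groupType) (f : {hom P -> Q}) : set K :=
  [set z | center K z /\ forall p, center_action (f p) z = z].

End CenterAction.

Record iterated_extension (K P R : groupType)
    (KNP : extension K P) (PQR : extension P R) := IteratedExtension {
  iext_group : groupType;
  iext_inj : {hom ext_group KNP -> iext_group};
  iext_proj : {hom iext_group -> ext_group PQR};
  iext_inj_injective : injective iext_inj;
  iext_proj_surjective : range iext_proj = setT;
  iext_comm : iext_proj \o iext_inj =1 ext_inj PQR \o ext_proj KNP;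
  iext_exact_inj : range iext_inj = ker (ext_proj PQR \o iext_proj);
  iext_exact_proj : range (iext_inj \o ext_inj KNP) = ker iext_proj }.

Definition main_extension (K P R : groupType)
    (KNP : extension K P) (PQR : extension P R)
    (E : iterated_extension KNP PQR) : extension K (ext_group PQR) :=
  @Extension _ _ (iext_group E)
    (iext_inj E \o ext_inj KNP : K -> iext_group E) (iext_proj E)
    (inj_comp (@iext_inj_injective _ _ _ _ _ E) (@ext_inj_injective _ _ KNP))
    (iext_proj_surjective E) (iext_exact_proj E).


(* For a group A of automorphisms of G stabilizing the image of i, the inner
   automorphisms of G by elements of that image, as a normal subgroup of A. *)
Section InnerNormal.
Variables (K G : groupType) (i : {hom K -> G}) (A : subgroup (Aut G)).
Hypothesis hA : sgset A `<=` sgset (Aut_stab (range i)).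

Definition inner_normal_set : set A :=
  [set x : A | inner_set (range i) (val x)].

Lemma inner_normal1 : inner_normal_set 1.
Proof. by exists 1; [exact: image_sg1|rewrite gmulf1]. Qed.
Lemma inner_normalM x y :
  inner_normal_set x -> inner_normal_set y -> inner_normal_set (x * y).
Proof.
move=> [a ia ax] [b ib bx]; exists (a * b); first exact: image_sgM.
by rewrite innerM ax bx.
Qed.
Lemma inner_normalV x : inner_normal_set x -> inner_normal_set x^-1.
Proof.
move=> [a ia ax]; exists a^-1; first exact: image_sgV.
by rewrite innerV ax.
Qed.

Definition inner_normal_sg : subgroup A :=
  Subgroup inner_normal1 inner_normalM inner_normalV.

Lemma inner_normalJ g x :
  sgset inner_normal_sg x -> sgset inner_normal_sg (g * x * g^-1).
Proof.
move=> [a ia ax]; exists ((val g : Aut G) a); last first.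
  by rewrite -aut_inner ax !gmulfM gmulfV.
have <- : Aut_stab_set (range i) (val g) := hA (subgroup_valP g).
by exists a.
Qed.

Definition inner_normal : normal_subgroup A := NormalSubgroup inner_normalJ.

End InnerNormal.

Section AutExtension.
Variables (K Q : groupType) (X : extension K Q).
Local Notation G := (ext_group X).
Local Notation i := (ext_inj X).

Definition Aut_KGQ : subgroup (Aut G) := Aut_rel i (ext_proj X).

Definition Aut_K : subgroup (Aut G) := Aut_stab (range i).

Lemma inner_sub_Aut_K : inner_set (range i) `<=` sgset Aut_K.
Proof.
move=> _ [_ [k _ <-] <-]; rewrite /= /Aut_stab_set /= predeqE => x; split.
  move=> [_ [k' _ <-] <-]; exists (k * k' * k^-1) => //.
  by rewrite !gmulfM gmulfV.
move=> [k' _ <-]; exists (i (k^-1 * k' * k)); first by exists (k^-1 * k' * k).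
by rewrite /= !gmulfM gmulfV !mulgA mulgV mul1g mulgK.
Qed.

(* Out(G;K); by [inner_sub_Aut_K], [inner_normal] contains all the inner
   automorphisms of G by elements of K. *)
Definition Out_K : groupType := quot (@inner_normal _ _ i Aut_K (fun _ h => h)).

Definition Out_K_class : {hom Aut_K -> Out_K} := @coset _ _.

Lemma Aut_KGQ_sub : sgset Aut_KGQ `<=` sgset Aut_K.
Proof. exact: Aut_rel_stab. Qed.

Definition Aut_KGQ_to_Out_K : {hom Aut_KGQ -> Out_K} :=
  Out_K_class \o sg_incl Aut_KGQ_sub.

Definition Out_KGQ : subgroup Out_K := image_sg Aut_KGQ_to_Out_K.
Definition Out_KGQ_class : {hom Aut_KGQ -> Out_KGQ} :=
  to_image Aut_KGQ_to_Out_K.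

End AutExtension.

Section AutIteratedExtension.
Variables (K P R : groupType) (KNP : extension K P) (PQR : extension P R).
Variable E : iterated_extension KNP PQR.
Local Notation G := (iext_group E).
Local Notation j := (iext_inj E).
Local Notation i := (ext_inj (main_extension E)).

Definition Aut_KNGQR : subgroup (Aut G) := Aut_rel j (iext_proj E).

Definition Aut_NK : subgroup (Aut G) :=
  setI_sg (Aut_stab (range j)) (Aut_stab (range i)).

Lemma inner_sub_Aut_NK : inner_set (range i) `<=` sgset Aut_NK.
Proof.
move=> xi Kxi; split; last exact: inner_sub_Aut_K Kxi.
case: Kxi => _ [k _ <-] <-; rewrite /= /Aut_stab_set /= predeqE => x; set n := ext_inj KNP k.
split=> [[_ [n' _ <-] <-]|[n' _ <-]].
  by exists (n * n' * n^-1) => //; rewrite !gmulfM gmulfV.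
exists (j (n^-1 * n' * n)); first by exists (n^-1 * n' * n).
by rewrite /= !gmulfM gmulfV !mulgA mulgV mul1g mulgK.
Qed.

(* Out_N(G;K); see [inner_sub_Aut_NK]. *)
Definition Out_NK : groupType := quot (@inner_normal _ _ i Aut_NK (fun _ => @proj2 _ _)).

Definition Out_NK_class : {hom Aut_NK -> Out_NK} := @coset _ _.

Lemma Aut_KNGQR_sub_KGQ : sgset Aut_KNGQR `<=` sgset (Aut_KGQ (main_extension E)).
Proof. by move=> xi [xij pxi]; split=> // k; apply: xij. Qed.

Lemma Aut_KNGQR_sub_NK : sgset Aut_KNGQR `<=` sgset Aut_NK.
Proof.
move=> xi Exi; split; first exact: (Aut_rel_stab Exi).
by apply: Aut_KGQ_sub; apply: Aut_KNGQR_sub_KGQ.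
Qed.

Definition Aut_KNGQR_to_Out_NK : {hom Aut_KNGQR -> Out_NK} :=
  Out_NK_class \o sg_incl Aut_KNGQR_sub_NK.

Definition Out_KNGQR : subgroup Out_NK := image_sg Aut_KNGQR_to_Out_NK.
Definition Out_KNGQR_class : {hom Aut_KNGQR -> Out_KNGQR} :=
  to_image Aut_KNGQR_to_Out_NK.

Definition Aut_KNGQR_incl : {hom Aut_KNGQR -> Aut_KGQ (main_extension E)} :=
  sg_incl Aut_KNGQR_sub_KGQ.

End AutIteratedExtension.

(* Main.v *)
Require Import Defs.
From HB Require Import structures.
From mathcomp Require Import ssreflect ssrfun ssrbool eqtype ssrnat choice.
From mathcomp Require Import monoid generic_quotient boolp classical_sets.

(** Two ideas carry the proof.

    For the map between the outer groups: an element of [Out_KNGQR E] and an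
    element of [Out_KGQ (main_extension E)] are both classes of automorphisms
    modulo the same subgroup, the inner automorphisms of G by elements of K; the
    ambient groups Aut_{N,K}(G) and Aut_K(G) differ, but the congruence does not
    see them ([Out_KNGQR_class_eq], [Out_KGQ_class_eq]).  So two automorphisms in
    Aut(KNGQR) have the same class on one side exactly when they do on the other,
    and the universal property of a surjective homomorphism ([hom_factor_inj])
    yields the homomorphism together with its injectivity.

    For the intersection statement: let z be central in K and let p be the image
    in P of n in N.  Since theta is the outer action of the main extension, p acts
    on z as conjugation by j(n) in G ([center_action_conj]).  If conjugation by
    i(z) fixes j(N) pointwise, then i(z) commutes with every j(n), so j(n)
    conjugates i(z) to itself, which says that p fixes z
    ([inner_fix_fixed_center]).  Thus an element z of Z(K) giving rise to xi is
    already in Z(K)^P. *)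

Local Open Scope classical_set_scope.
Local Open Scope group_scope.

(** Choosing a preimage under p before applying f does not depend on the choice,
    because p x = p y implies f x = f y; the opposite implication is the
    injectivity of the factorization. *)
Lemma hom_factor_inj {A B C : groupType} {p : {hom A -> B}} {f : {hom A -> C}} :
  (forall b, exists a, p a = b) ->
  (forall x y, p x = p y <-> f x = f y) ->
  exists h : {hom B -> C}, (forall a, h (p a) = f a) /\ injective h.
Proof.
move=> p_surj pf.
pose h (b : B) : C := f (sval (cid (p_surj b))).
have hp a : h (p a) = f a by rewrite /h; case: cid => a' /= /pf.
have h_morph : {morph h : x y / x / y}.
  move=> x y; have [a <-] := p_surj x; have [b <-] := p_surj y.
  by rewrite -gmulfF !hp gmulfF.
pose hM := isGroupMorphism.Build B C h h_morph.
pose H : {hom B -> C} := HB.pack h hM.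
exists H; split=> [a|x y]; first exact: hp.
have [a <-] := p_surj x; have [b <-] := p_surj y.
by rewrite [_ = _](congr2 eq (hp a) (hp b)) => /pf.
Qed.

(** A class in the image of Aut(KGQ) is a coset in Aut_K(G), and the congruence
    of Aut_K(G) is tested on underlying automorphisms of G.  Stating it there
    makes the criterion comparable with [Out_KNGQR_class_eq], whose cosets live
    in another group. *)
Lemma Out_KGQ_class_eq {K Q : groupType} (X : extension K Q)
    (x y : Aut_KGQ X) :
  Out_KGQ_class X x = Out_KGQ_class X y <->
  inner_set (range (ext_inj X)) ((val x)^-1 * val y).
Proof.
split=> [/(congr1 val) /coset_eq // | xy].
by apply: val_inj; apply/coset_eq.
Qed.

Section IteratedExtension.
Context {K P R : groupType} {PQR : extension P R} {KNP : extension K P}.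
Variable E : iterated_extension KNP PQR.
Local Notation i := (ext_inj (main_extension E)).
Local Notation j := (iext_inj E).

Lemma Out_KNGQR_class_eq (x y : Aut_KNGQR E) :
  Out_KNGQR_class E x = Out_KNGQR_class E y <->
  inner_set (range i) ((val x)^-1 * val y).
Proof.
split=> [/(congr1 val) /coset_eq // | xy].
by apply: val_inj; apply/coset_eq.
Qed.

Lemma Out_KNGQR_class_surj (u : Out_KNGQR E) :
  exists xi, Out_KNGQR_class E xi = u.
Proof.
by have [xi _ xiE] := subgroup_valP u; exists xi; apply: val_inj.
Qed.

Context {theta : {hom ext_group PQR -> Out K}}.
Hypothesis Htheta : outer_action (main_extension E) =1 theta.

(** Compatibility of the two projections turns a lift of p to N into a lift of
    its image in Q to G, and the action on the centre does not depend on
    the lift. *)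
Lemma center_action_conj (n : ext_group KNP) (z : K) : center K z ->
  i (center_action theta (ext_inj PQR (ext_proj KNP n)) z) =
  j n * i z * (j n)^-1.
Proof.
move=> zK.
have thetaE : theta (ext_inj PQR (ext_proj KNP n)) =
    coset (Inn K) (ext_conj (X := main_extension E) (j n)).
  rewrite -Htheta -[ext_inj PQR _](iext_comm E n).
  exact: (@outer_actionE _ _ (main_extension E)).
rewrite (center_actionE thetaE zK).
exact: (@ext_conj_funE _ _ (main_extension E)).
Qed.

(** To fix j(n) under conjugation by i(z) is to commute with i(z), a condition
    symmetric in the two elements; it is reread as j(n) fixing i(z). *)
Lemma inner_fix_fixed_center (z : K) : center K z ->
  (forall n, inner (i z) (j n) = j n) ->
  fixed_center theta (ext_inj PQR) z.
Proof.
move=> zK zj; split=> // p; have [n <-] := ext_lift_ex KNP p.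
apply: (@ext_inj_injective _ _ (main_extension E)).
rewrite center_action_conj //.
by rewrite -[X in X * i z](zj n) /= mulgVK mulgK.
Qed.

End IteratedExtension.

Theorem proposition6p3 (K P R : groupType) (PQR : extension P R)
    (theta : {hom ext_group PQR -> Out K}) (KNP : extension K P)
    (E : iterated_extension KNP PQR)
    (Htheta : outer_action (main_extension E) =1 theta) :
  (exists h : {hom Out_KNGQR E -> Out_KGQ (main_extension E)},
     (forall xi : Aut_KNGQR E,
        h (Out_KNGQR_class E xi) =
        Out_KGQ_class (main_extension E) (Aut_KNGQR_incl E xi)) /\
     injective h) /\
  (forall xi : Aut (iext_group E), sgset (Aut_KNGQR E) xi ->
     inner_set (ext_inj (main_extension E) @` center K) xi <->
     inner_set (ext_inj (main_extension E) @`
                  fixed_center theta (ext_inj PQR)) xi).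
Proof.
split.
  pose f : {hom Aut_KNGQR E -> Out_KGQ (main_extension E)} :=
    Out_KGQ_class (main_extension E) \o Aut_KNGQR_incl E.
  apply: (hom_factor_inj (f := f) (Out_KNGQR_class_surj E)) => x y.
  by rewrite Out_KNGQR_class_eq -[f x = f y]/(_ = _) Out_KGQ_class_eq.
move=> xi [xij _]; split=> [[_ [z zK <-] zxi]|[_ [z [zK _] <-] zxi]].
  exists (ext_inj (main_extension E) z) => //; exists z => //.
  by apply: (inner_fix_fixed_center _ Htheta) => // n; rewrite zxi xij.
by exists (ext_inj (main_extension E) z) => //; exists z.
Qed.
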